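(* Let $\gamma>0$. Let $X_T$ be the value at time $T$ of the solution of an SDE and, for each step size $\Delta>0$, let $X_T^{\Delta}$ denote the value at time $T$ of a time-discrete approximation with step size $\Delta$, where $X_T$ and all the $X_T^{\Delta}$ are constructed from the same Wiener process. Then the following are equivalent: (i) there is a constant $C_1$, independent of $\Delta$, such that $E\left|X_T-X_T^{\Delta}\right|<C_1\Delta^{\gamma}$ for all sufficiently small $\Delta>0$; (ii) the scheme is strongly convergent, i.e. $\lim_{\Delta\to0}E\left|X_T-X_T^{\Delta}\right|=0$, and for every integer $k>1$ there is a constant $C_2$, independent of $\Delta$, such that $E\left|X_T^{\Delta}-X_T^{\Delta/k}\right|<C_2\Delta^{\gamma}$ for all sufficiently small $\Delta>0$, where $X_T^{\Delta/k}$ is the approximation with step size $\Delta/k$ built from the same Wiener process.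
   Context: $X_T$ and $X_T^{\Delta}$ ($\Delta>0$) are real-valued integrable random variables on one common probability space. Only the family $(X_T^{\Delta})_{\Delta>0}$ and $X_T$ enter the statement; no particular discretization scheme or SDE is assumed. The constant $C_2$ (and the threshold for ''sufficiently small'') may depend on $k$. *)

(* Defs.v *)
From mathcomp Require Export all_boot all_order all_algebra.
From mathcomp Require Export all_classical all_reals all_analysis.
Export numFieldNormedType.Exports.

Set Implicit Arguments.
Unset Strict Implicit.
Unset Printing Implicit Defensive.

Local Open Scope classical_set_scope.
Local Open Scope ring_scope.

(* Only the values XD Delta with Delta > 0 matter: the limit is one-sided. *)
Definition strongly_convergent (d : measure_display) (Omega : measurableType d)
    (R : realType) (P : probability Omega R) (X : {RV P >-> R})
    (XD : R -> {RV P >-> R}) : Prop :=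
  ('E_P[fun w => `|X w - XD Delta w|%R])%E @[Delta --> 0^'+] --> 0%E.

(* Main.v *)
(* Only [k = 2] is needed for (ii) => (i). Write [e Delta = E|X_T - X_T^Delta|]
   and [q = 2^(-gamma) < 1]. With [M = C / (1 - q)] the step bound
   [e x <= e (x / 2) + C x^gamma] says that [e x - M x^gamma] does not decrease
   when [x] is halved; as it is at most [e x], which vanishes at 0, it is
   nonpositive near 0. *)
Require Import Defs.
From mathcomp Require Import lra measurable_realfun.
Set Implicit Arguments.
Unset Strict Implicit.
Unset Printing Implicit Defensive.

Import Order.TTheory GRing.Theory Num.Theory.

Local Open Scope classical_set_scope.
Local Open Scope ring_scope.

(** An explicit interval ]0, r[ is stable under division by any number at least 1, so a bound known
    near 0 can be used again at x / 2^n or Delta / k with the same r. *)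
Lemma near_at_right0P (R : realType) (Q : set R) :
  (\forall x \near 0^'+, Q x) <->
  exists2 r : R, 0 < r & forall x, 0 < x < r -> Q x.
Proof.
split=> [[r /= r0 Qr]|[r r0 Qr]].
  exists r => // x /andP[x0 xr]; apply: Qr => //=.
  by rewrite sub0r normrN gtr0_norm.
near=> x; apply: Qr; apply/andP; split; near: x.
  exact: nbhs_right_gt.
exact: nbhs_right_lt.
Unshelve. all: by end_near. Qed.

Lemma cvg_at_right0_le_of_halving (R : realType) (e : R -> R) (C gamma : R) :
  0 < gamma -> 0 <= C -> e x @[x --> 0^'+] --> 0 ->
  (\forall x \near 0^'+, e x <= e (x / 2) + C * x `^ gamma) ->
  \forall x \near 0^'+, e x <= C / (1 - 2^-1 `^ gamma) * x `^ gamma.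
Proof.
move=> g0 C0 e0 /near_at_right0P[r r0 step].
set q := 2^-1 `^ gamma; set M := C / (1 - q).
have q1 : q < 1.
  suff : q < 1 `^ gamma by rewrite powR1.
  by apply: gt0_ltr_powR; rewrite ?nnegrE//; lra.
have M0 : 0 <= M by rewrite divr_ge0// subr_ge0 ltW.
(* This equation dictates [M]: as (x / 2)^gamma = q x^gamma, halving x lowers M x^gamma by exactly C
   x^gamma, the error term of [step]. *)
have CM : C = M * (1 - q) by rewrite /M divfK//; lra.
apply/near_at_right0P; exists r => // x x_r.
have halved n : 0 < x / 2 ^+ n < r.
  have /andP[x0 xr] := x_r.
  rewrite divr_gt0 ?exprn_gt0//= (le_lt_trans _ xr)//.
  by rewrite ler_pdivrMr ?exprn_gt0// ler_peMr ?exprn_ege1 ?ltW//; lra.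
have mono n : e x - M * x `^ gamma <= e (x / 2 ^+ n).
  suff : e x - M * x `^ gamma
      <= e (x / 2 ^+ n) - M * (x / 2 ^+ n) `^ gamma.
    by have := mulr_ge0 M0 (powR_ge0 (x / 2 ^+ n) gamma); lra.
  elim: n => [|n IH]; first by rewrite expr0 divr1.
  apply: (le_trans IH); have := step _ (halved n).
  have -> : x / 2 ^+ n.+1 = x / 2 ^+ n / 2 by rewrite exprSr invfM mulrA.
  rewrite (powRM gamma (x := x / 2 ^+ n)) ?invr_ge0//; last first.
    by have /andP[/ltW] := halved n.
  by rewrite -/q {1}CM; lra.
rewrite -subr_le0; apply/ler_addgt0Pr => eps eps0; rewrite add0r.
have /near_at_right0P[s s0 small] : \forall y \near 0^'+, e y < eps.
  exact: cvgr_lt e0 _ eps0.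
have [n xn] : exists n : nat, x / 2 ^+ n < s.
  have /andP[x0 _] := x_r.
  (* This n exceeds x / s, and 2^n > n. *)
  exists (Num.truncn (x / s)).+1.
  rewrite ltr_pdivrMr ?exprn_gt0// mulrC -ltr_pdivrMr//.
  apply: (lt_trans (truncnS_gt _)).
  by rewrite -natrX ltr_nat ltn_expl.
apply: (le_trans (mono n)); apply/ltW/small.
by have /andP[-> _] := halved n.
Qed.

Section L1_distance.
Context (R : realType) (d : measure_display) (T : measurableType d).
Context (P : probability T R).
Implicit Types U V W : {RV P >-> R}.

(** Taking [fine] gives real numbers, on which [lra] and real limits work. As [fine] sends an
    infinite expectation to 0, integrability is what makes the value faithful. *)
Definition L1dist U V : R := fine 'E_P[fun w => `|U w - V w|%R].

Lemma L1distE U V : P.-integrable setT (EFin \o U) ->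
  P.-integrable setT (EFin \o V) ->
  'E_P[fun w => `|U w - V w|%R]%E = (L1dist U V)%:E.
Proof.
move=> iU iV; rewrite /L1dist fineK// unlock; apply: integrable_fin_num => //.
have iUV := integrableB measurableT iU iV.
exact: (@integrable_norm _ _ _ P setT (fun w => U w - V w)).
Qed.

Lemma L1dist_ge0 U V : 0 <= L1dist U V.
Proof. by apply/fine_ge0/expectation_ge0 => w. Qed.

Lemma L1distC U V : L1dist U V = L1dist V U.
Proof. by congr (fine 'E_P[_]); apply/funext => w; rewrite distrC. Qed.

Lemma L1dist_triangle U V W : P.-integrable setT (EFin \o U) ->
  P.-integrable setT (EFin \o V) -> P.-integrable setT (EFin \o W) ->
  L1dist U W <= L1dist U V + L1dist V W.
Proof.
move=> iU iV iW; rewrite -lee_fin EFinD -!L1distE//.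
have mdist (A B : {RV P >-> R}) :
    measurable_fun setT (fun w => `|A w - B w|).
  apply: measurableT_comp => //.
  exact: measurable_funB.
rewrite unlock -ge0_integralD//; try by exact/measurable_EFinP.
apply: ge0_le_integral => //.
- exact/measurable_EFinP.
- by apply: emeasurable_funD; exact/measurable_EFinP.
- by move=> w _; rewrite -EFinD lee_fin ler_distD.
Qed.

End L1_distance.

Theorem theorem2p1 (R : realType) (d : measure_display)
    (Omega : measurableType d) (P : probability Omega R)
    (X : {RV P >-> R}) (XD : R -> {RV P >-> R}) (gamma : R)
    (gamma_gt0 : 0 < gamma)
    (intX : P.-integrable setT (EFin \o X))
    (intXD : forall Delta : R, 0 < Delta ->
      P.-integrable setT (EFin \o XD Delta)) :
  (exists C1 : R, \forall Delta \near (0 : R)^'+,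
     ('E_P[fun w => `|X w - XD Delta w|%R] < (C1 * Delta `^ gamma)%:E)%E)
  <->
  (strongly_convergent X XD /\
   forall k : nat, (1 < k)%N ->
     exists C2 : R, \forall Delta \near (0 : R)^'+,
       ('E_P[fun w => `|XD Delta w - XD (Delta / k%:R) w|%R]
          < (C2 * Delta `^ gamma)%:E)%E).
Proof.
have XE Delta : 0 < Delta ->
    'E_P[fun w => `|X w - XD Delta w|%R]%E = (L1dist X (XD Delta))%:E.
  by move=> D0; apply: L1distE => //; exact: intXD.
have XDE (k : nat) Delta : (1 < k)%N -> 0 < Delta ->
    'E_P[fun w => `|XD Delta w - XD (Delta / k%:R) w|%R]%E
    = (L1dist (XD Delta) (XD (Delta / k%:R)))%:E.
  move=> k1 D0; apply: L1distE; apply: intXD => //.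
  by rewrite divr_gt0// ltr0n ltnW.
have convE : strongly_convergent X XD <->
    L1dist X (XD Delta) @[Delta --> 0^'+] --> (0 : R).
  (* [XD Delta] need not be integrable for Delta <= 0, so the real and extended distances are only
     compared to the right of 0. *)
  have eqE : \forall Delta \near 0^'+,
      (L1dist X (XD Delta))%:E = 'E_P[fun w => `|X w - XD Delta w|%R]%E.
    by near=> Delta; rewrite XE.
  split=> [/fine_cvg//|cv].
  apply: cvg_trans (near_eq_cvg eqE) _.
  by apply: cvg_EFin => //; near=> Delta.
split=> [[C1 /near_at_right0P[r r0 bound]]|[/convE conv /(_ 2 isT)[C2 bound]]].
  have {}bound Delta : 0 < Delta < r ->
      L1dist X (XD Delta) < C1 * Delta `^ gamma.
    by move=> /[dup] /andP[D0 _] /bound; rewrite XE// lte_fin.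
  split=> [|k k1].
    apply/convE; apply: (squeeze_cvgr (f := cst 0)
        (h := fun Delta => C1 * Delta `^ gamma)).
    - apply/near_at_right0P; exists r => // Delta /bound/ltW ->.
      by rewrite L1dist_ge0.
    - exact: cvg_cst.
    - rewrite -[X in _ --> X](mulr0 C1); apply: cvgMr.
      exact: powR_cvg0.
  have k0 : 0 < k%:R :> R by rewrite ltr0n ltnW.
  (* The triangle inequality through [X] gives C1 Delta^gamma + C1 (Delta / k)^gamma, and k^(-gamma)
     factors out of the second term. *)
  exists (C1 + C1 * k%:R^-1 `^ gamma).
  apply/near_at_right0P; exists r => // Delta Dr.
  have /andP[D0 Dlt] := Dr.
  have Dkr : 0 < Delta / k%:R < r.
    rewrite divr_gt0//= (le_lt_trans _ Dlt)// ler_pdivrMr//.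
    by apply: ler_peMr; [exact: ltW | rewrite ler1n ltnW].
  have /andP[Dk0 _] := Dkr.
  rewrite XDE// lte_fin.
  apply: (le_lt_trans (L1dist_triangle (intXD _ D0) intX (intXD _ Dk0))).
  rewrite mulrDl ltrD//; first by rewrite L1distC bound.
  apply: (lt_le_trans (bound _ Dkr)).
  by rewrite powRM ?invr_ge0 ?(ltW D0) ?(ltW k0)// mulrCA mulrC.
have /near_at_right0P[r r0 {}bound] := bound.
have {}bound Delta : 0 < Delta < r ->
    L1dist (XD Delta) (XD (Delta / 2)) < C2 * Delta `^ gamma.
  by move=> /[dup] /andP[D0 _] /bound; rewrite XDE// lte_fin.
(* At Delta = r / 2 a nonnegative distance lies strictly below C2 Delta^gamma, which forces the
   sign. *)
have C2_ge0 : 0 <= C2.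
  have r2 : 0 < r / 2 < r by lra.
  have := le_lt_trans (L1dist_ge0 _ _) (bound _ r2).
  by rewrite pmulr_lgt0 ?powR_gt0//; [exact: ltW | lra].
have step : \forall Delta \near 0^'+, L1dist X (XD Delta)
    <= L1dist X (XD (Delta / 2)) + C2 * Delta `^ gamma.
  apply/near_at_right0P; exists r => // Delta Dr.
  have /andP[D0 _] := Dr.
  have D20 : 0 < Delta / 2 by lra.
  apply: (le_trans (L1dist_triangle intX (intXD _ D20) (intXD _ D0))).
  by rewrite lerD2l L1distC ltW// bound.
(* The halving argument yields a weak inequality; the extra 1 makes it strict, because Delta^gamma >
   0. *)
exists (C2 / (1 - 2^-1 `^ gamma) + 1).
have rate := cvg_at_right0_le_of_halving gamma_gt0 C2_ge0 conv step.
near=> Delta.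
have D0 : 0 < Delta by [].
rewrite XE// lte_fin mulrDl mul1r ltr_pwDr ?powR_gt0//.
by near: Delta.
Unshelve. all: by end_near. Qed.
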